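(* Let $q_0$ be a prime power, $q=q_0^2$, let $m$ be a divisor of $q_0+1$, and let $\mathcal X_m$ be the non-singular model of the plane curve over $\mathbb F_q$ with affine equation $$Y^m=X^{q_0}+X .$$ Let $\bar P_\infty$ be the unique $\mathbb F_q$-rational point of $\mathcal X_m$ centred at the only point at infinity of this plane curve. Then the Weierstrass semigroup of $\mathcal X_m$ at $\bar P_\infty$ is $$H(\bar P_\infty)=\langle m, q_0\rangle .$$
   Context: Curves are projective, geometrically irreducible, non-singular algebraic curves over a finite field. For an $\mathbb F_q$-rational point $P$, $H(P)$ is the Weierstrass semigroup of non-gaps at $P$: the set of integers $n\ge 0$ such that there is a rational function with pole divisor $nP$. $\langle a,b\rangle$ denotes the numerical semigroup (containing $0$) generated by $a$ and $b$. *)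

(* Defs.v *)
From HB Require Import structures.
From mathcomp Require Import all_boot all_order all_algebra.

Set Implicit Arguments.
Unset Strict Implicit.
Unset Printing Implicit Defensive.

Import Order.TTheory GRing.Theory Num.Theory.
Local Open Scope ring_scope.

(* Bivariate polynomials follow polyXY: in {poly {poly F}} the outer variable
   'X is X and 'Y := 'X%:P is Y, so that f`_i`_j is the coefficient of
   X^i Y^j. *)
Definition eval_xy (F K : fieldType) (iota : {rmorphism F -> K}) (x y : K)
    (g : {poly {poly F}}) : K :=
  (map_poly (map_poly iota) g).[x, y].

(* Up to a unique isomorphism compatible with iota, x and y, this says that
   K = Frac (F[X,Y] / (f)) with x, y the classes of X and Y. *)
Record is_function_field (F K : fieldType) (iota : {rmorphism F -> K})
    (x y : K) (f : {poly {poly F}}) : Prop := IsFunctionField {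
  eval_xy_ker : forall g : {poly {poly F}},
    eval_xy iota x y g = 0 <-> exists h : {poly {poly F}}, g = f * h;
  eval_xy_frac : forall z : K, exists g h : {poly {poly F}},
    eval_xy iota x y h != 0 /\ z = eval_xy iota x y g / eval_xy iota x y h }.

(* The closed points of the non-singular projective model of a plane curve
   with function field K over F are the discrete valuation rings of K
   containing F and with fraction field K; each is represented by its
   normalized valuation.  The value at 0, mathematically +oo, is set to 0 so
   that a point is determined by the underlying function; hence all valuation
   conditions below treat 0 separately. *)
Record point (F K : fieldType) (iota : {rmorphism F -> K}) := Point {
  ord :> K -> int;
  ord0 : ord 0 = 0;
  ordM : forall z w : K, z != 0 -> w != 0 -> ord (z * w) = ord z + ord w;
  ordD : forall z w : K, z != 0 -> w != 0 -> z + w != 0 ->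
    Num.min (ord z) (ord w) <= ord (z + w);
  ord_const : forall c : F, c != 0 -> ord (iota c) = 0;
  ord_normalized : exists2 t : K, t != 0 & ord t = 1 }.

Section Points.
Variables (F K : fieldType) (iota : {rmorphism F -> K}).
Implicit Types (P Q : point iota) (z : K).

Definition regular_at P z : bool := (z == 0) || (0 <= P z).

Definition vanishes_at P z : bool := (z == 0) || (0 < P z).

(* The residue field at P is F. *)
Definition rational_point P : Prop :=
  forall z, regular_at P z -> exists c : F, vanishes_at P (z - iota c).

(* The rational map (x : y : 1) to the projective plane sends P to
   (a : b : c). *)
Definition centred_at (x y : K) P (a b c : F) : Prop :=
  (a, b, c) != (0, 0, 0) /\
  exists t : K, [/\ t != 0, vanishes_at P (t * x - iota a),
    vanishes_at P (t * y - iota b) & vanishes_at P (t - iota c)].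

Definition pole_order P z : int := Num.max 0 (- P z).

Definition has_pole_divisor z (n : nat) P : Prop :=
  forall Q, (Q =1 P -> pole_order Q z = n%:Z) /\
            (~ (Q =1 P) -> pole_order Q z = 0).

Definition weierstrass_semigroup P (n : nat) : Prop :=
  exists2 z : K, z != 0 & has_pole_divisor z n P.

End Points.

Definition total_degree (F : fieldType) (f : {poly {poly F}}) : nat :=
  \max_(i < size f) \max_(j < size (f`_i)%R | (f`_i`_j != 0)%R) (i + j)%N.

(* Value at (a, b, c) of the homogenization of f. *)
Definition homogenized_eval (F : fieldType) (f : {poly {poly F}})
    (a b c : F) : F :=
  \sum_(i < size f) \sum_(j < size f`_i)
    f`_i`_j * a ^+ i * b ^+ j * c ^+ (total_degree f - (i + j)).

(* (a : b : 0) is a point at infinity of the plane curve f = 0. *)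
Definition point_at_infinity (F : fieldType) (f : {poly {poly F}})
    (a b : F) : Prop :=
  (a, b) != (0, 0) /\ homogenized_eval f a b 0 = 0.

Definition curve_poly (F : fieldType) (q0 m : nat) : {poly {poly F}} :=
  'Y ^+ m - ('X ^+ q0 + 'X).

Definition numerical_semigroup2 (a b n : nat) : Prop :=
  exists i j : nat, n = (i * a + j * b)%N.

(* Main.v *)
Require Import Defs.
From mathcomp Require Import all_boot all_order all_algebra all_field.
From mathcomp Require Import zify ring.
Set Implicit Arguments.
Unset Strict Implicit.
Unset Printing Implicit Defensive.
Import Order.TTheory GRing.Theory Num.Theory.
Local Open Scope ring_scope.

(** Let A = F[x, y] be the ring of the affine curve and B = F[y].  The equation
    X ^ q0 + X = Y ^ m is monic of degree q0 in X, so A is free over B on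
    1, x, ..., x ^ (q0 - 1).

    At a point where x has a pole, the equation forces the orders of x and y to
    be proportional to - m and - q0.  As m and q0 are coprime, the monomials
    x ^ i y ^ j with i < q0 then have pairwise different orders, so the orders
    of all elements of A, hence of the whole function field, are determined by
    those of x and y.  Normalization gives exactly - m and - q0 ([ord_xy]), and
    there is at most one such point ([pole_x_uniq]).  A point centred at
    infinity is a pole of x, so it is this one.

    Thus x ^ i y ^ j has order - (i m + j q0) there and no pole elsewhere.
    Conversely, an element of A has at infinity the pole order of one of its
    monomials ([ord_evalXY]), so the theorem follows once a function z without
    affine poles is known to lie in A ([regular_off_poles_polynomial]), which
    says that A is integrally closed.

    The derivative in X of the equation is 1, so A is unramified over B, and
    this makes the affine points explicit.  At a solution (x0, y0) over
    a finite extension of F, the function t = y - y0 is a parameter, X expands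
    as a power series in t, and the order of this expansion is a point of the
    curve in which exactly the polynomials that vanish at (x0, y0) have
    positive order ([plane_point_exists]).  Write z = g(x, y) / h(y) with g of
    degree less than q0 in X.  If h has a root y0, regularity of z makes
    g(X, y0) vanish at the q0 different solutions X of X ^ q0 + X = y0 ^ m, so
    every coefficient of g vanishes at y0, and the fraction simplifies.
    Repeating this until h is constant puts z in A. *)

(** * Orders at a point *)

Section PointOrders.
Variables (F K : fieldType) (iota : {rmorphism F -> K}).
Implicit Types (P Q : point iota) (z w : K).

Lemma ord1 P : P 1 = 0.
Proof. by rewrite -(rmorph1 iota) ord_const ?oner_eq0. Qed.

Lemma ordN P z : P (- z) = P z.
Proof.
have [->|z0] := eqVneq z 0; first by rewrite oppr0.
have N1 : -1 != 0 :> K by rewrite oppr_eq0 oner_eq0.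
have PN1 : P (-1) = 0.
  by rewrite -[-1](rmorphN1 iota) ord_const // oppr_eq0 oner_eq0.
by rewrite -mulN1r ordM // PN1 add0r.
Qed.

Lemma ordX P z n : z != 0 -> P (z ^+ n) = P z * n%:Z.
Proof.
move=> z0; elim: n => [|n IHn]; first by rewrite expr0 ord1 mulr0.
by rewrite exprS ordM ?expf_neq0 // IHn intS mulrDr mulr1.
Qed.

Lemma ordD_lt P z w : z != 0 -> w != 0 -> P z < P w ->
  z + w != 0 /\ P (z + w) = P z.
Proof.
move=> z0 w0 ltzw; have zw0 : z + w != 0.
  apply: contraTneq ltzw => /eqP; rewrite addr_eq0 => /eqP->.
  by rewrite ordN ltxx.
split=> //; apply/eqP; rewrite eq_le; apply/andP; split; last first.
  by have := ordD P z0 w0 zw0; rewrite (min_idPl (ltW ltzw)).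
have Nw0 : - w != 0 by rewrite oppr_eq0.
have := ordD P zw0 Nw0; rewrite addrK ordN => /(_ z0); rewrite ge_min.
by rewrite [P w <= _]leNgt ltzw orbF.
Qed.

Lemma ordD_neq P z w : z != 0 -> w != 0 -> P z != P w ->
  z + w != 0 /\ P (z + w) = Num.min (P z) (P w).
Proof.
move=> z0 w0; case: ltgtP => // lt_zw _.
  exact: ordD_lt.
by rewrite addrC; exact: ordD_lt.
Qed.

(** Only terms of equal order can cancel, so a sum of terms of pairwise
    different orders has the order of its dominant term. *)
Lemma ord_sum_uniq P (I : eqType) (s : seq I) (E : I -> K) :
    s != [::] -> {in s, forall i, E i != 0} -> uniq [seq P (E i) | i <- s] ->
  \sum_(i <- s) E i != 0 /\
  exists2 i, i \in s &
    P (\sum_(i <- s) E i) = P (E i) /\ {in s, forall j, P (E i) <= P (E j)}.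
Proof.
elim: s => // i [_ _ E0 _|j s IHs _ E0].
  rewrite big_seq1 E0 ?mem_head //; split=> //; exists i; rewrite ?mem_head //.
  by split=> // j; rewrite inE => /eqP->.
rewrite map_cons cons_uniq => /andP[Pi us]; rewrite big_cons.
have [//||sum0 [k ks [Pk mink]]] := IHs _ _ us.
  by move=> k ks; rewrite E0 // inE ks orbT.
have Ei : E i != 0 by rewrite E0 ?mem_head.
have neqP : P (E i) != P (\sum_(i <- j :: s) E i).
  by rewrite Pk; apply: contraNneq Pi => ->; apply: (map_f (fun i => P (E i))).
have [-> ->] := ordD_neq Ei sum0 neqP; split=> //; rewrite Pk in neqP *.
have [le_ik|lt_ki] := leP (P (E i)) (P (E k)).
  exists i; rewrite ?mem_head; split=> // l; rewrite inE => /predU1P[-> //|ls].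
  exact: le_trans (mink l ls).
exists k; first by rewrite inE ks orbT.
split=> // l; rewrite inE => /predU1P[->|]; [exact: ltW | exact: mink].
Qed.

Lemma regularD P z w :
  regular_at P z -> regular_at P w -> regular_at P (z + w).
Proof.
rewrite /regular_at; have [->|z0] := eqVneq z 0; first by rewrite add0r.
have [->|w0] := eqVneq w 0; first by rewrite addr0 (negbTE z0).
have [//|zw0] := eqVneq; rewrite /= => Pz Pw.
by apply: le_trans (ordD P z0 w0 zw0); rewrite le_min Pz.
Qed.

Lemma regularM P z w :
  regular_at P z -> regular_at P w -> regular_at P (z * w).
Proof.
rewrite /regular_at mulf_eq0; case: (eqVneq z 0) => // z0.
by case: (eqVneq w 0) => //= w0 Pz Pw; rewrite ordM ?addr_ge0.
Qed.

Lemma regularX P z n : regular_at P z -> regular_at P (z ^+ n).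
Proof.
move=> Pz; elim: n => [|n IHn]; last by rewrite exprS regularM.
by rewrite expr0 /regular_at ord1 lexx orbT.
Qed.

Lemma ord_vanishes P z (a : F) : a != 0 -> vanishes_at P (z - iota a) ->
  z != 0 /\ P z = 0.
Proof.
move=> a0; have ia0 : iota a != 0 by rewrite fmorph_eq0.
rewrite /vanishes_at subr_eq0 => /predU1P[->|]; first by rewrite ord_const.
have [->|za0] := eqVneq (z - iota a) 0; first by rewrite Defs.ord0 ltxx.
by rewrite -(ord_const P a0) => /(ordD_lt ia0 za0); rewrite addrC subrK.
Qed.

End PointOrders.

(** * Arithmetic and finite extensions *)

Lemma lin_comb_inj (a b i j i' j' : nat) : coprime a b -> (0 < b)%N ->
    (i < b)%N -> (i' < b)%N -> (i * a + j * b = i' * a + j' * b)%N ->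
  i = i' /\ j = j'.
Proof.
move=> co_ab b_gt0.
wlog le_ii' : i i' j j' / (i <= i')%N => [th_sym|] lt_ib lt_i'b E.
  have [le_ii'|/ltnW le_i'i] := leqP i i'; first exact: th_sym.
  by have [||||-> ->] := th_sym i' i j' j.
have : (b %| (i' - i) * a)%N.
  have -> : ((i' - i) * a = (j - j') * b)%N by rewrite !mulnBl; lia.
  exact: dvdn_mull.
rewrite Gauss_dvdl 1?coprime_sym // => /dvdnP[[|c] ii'].
  have Ei : i = i' by lia.
  split=> //; apply/eqP; rewrite -(eqn_pmul2r b_gt0).
  by move: E; rewrite Ei; lia.
by rewrite mulSn in ii'; lia.
Qed.

Lemma finite_splitting_extension (F : finFieldType) (f : {poly F}) : f != 0 ->
  exists (L : finFieldType) (iL : {rmorphism F -> L}) (s : seq L),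
    map_poly iL f %= \prod_(z <- s) ('X - z%:P).
Proof.
move=> /FinSplittingFieldFor[L [s Df _]].
by exists (finvect_type L), (in_alg L : {rmorphism F -> L}), s.
Qed.

(** The q0 points of the fibre over y0 are different because X ^ q0 + X - y0 ^ m
    has derivative 1.  Working in a finite field L, and not in an algebraic
    closure, later provides the uniformizer y ^ |L| - y. *)
Lemma exists_fibre (F : finFieldType) (q0 m : nat) (h : {poly F}) :
    (1 < q0)%N -> [pchar F].-nat q0 -> (1 < size h)%N ->
  exists (L : finFieldType) (iL : {rmorphism F -> L}) (y0 : L) (s : seq L),
    [/\ root (map_poly iL h) y0, uniq s, size s = q0 &
        {in s, forall x0, x0 ^+ q0 + x0 = y0 ^+ m}].
Proof.
move=> q0_gt1 q0_char h_gt1.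
have h0 : h != 0 by rewrite -size_poly_gt0 ltnW.
have [L1 [i1 [[|y1 s1] hE]]] := finite_splitting_extension h0.
  by move: (eqp_size hE) h_gt1; rewrite size_map_poly big_nil size_poly1 => ->.
have hy1 : root (map_poly i1 h) y1.
  by rewrite (eqp_root hE) root_prod_XsubC mem_head.
pose f := 'X^q0 + ('X - (y1 ^+ m)%:P).
have size_f : size f = q0.+1.
  by rewrite size_polyDl size_polyXn // size_XsubC ltnS.
have sep_f : separable_poly f.
  have q0F : q0%:R = 0 :> F.
    apply/eqP; apply: contraTT q0_gt1.
    by rewrite natf_neq0_pchar => /(pnat_1 q0_char)->.
  have q0L : q0%:R = 0 :> {poly L1}.
    by rewrite -polyC_natr -(rmorph_nat i1) q0F rmorph0 polyC0.
  rewrite unlock derivD derivXn derivXsubC -mulr_natr q0L mulr0 add0r.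
  exact: coprimep1.
have f0 : f != 0 by rewrite -size_poly_gt0 size_f.
have [L [i2 [s fE]]] := finite_splitting_extension f0.
exists L, (i2 \o i1 : {rmorphism F -> L}), (i2 y1), s; split.
- by rewrite map_poly_comp fmorph_root.
- by rewrite -separable_prod_XsubC -(eqp_separable fE) separable_map.
- apply: succn_inj; rewrite -size_f -(size_map_poly i2) (eqp_size fE).
  exact/esym/size_prod_XsubC.
move=> x0; rewrite -root_prod_XsubC -(eqp_root fE) rootE.
rewrite !rmorphD rmorphN /= map_polyXn map_polyX map_polyC.
rewrite !(hornerD, hornerN, hornerX, hornerXn, hornerC).
by rewrite addrA subr_eq0 => /eqP->; exact: rmorphXn.
Qed.

(** The greatest common divisor of the polynomials that vanish at y0 does so
    too, since it is a linear combination of them. *)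
Lemma exists_common_divisor (F L : fieldType) (iL : {rmorphism F -> L}) (y0 : L)
    (h : {poly F}) (s : seq {poly F}) :
    h != 0 -> root (map_poly iL h) y0 ->
    {in s, forall c, root (map_poly iL c) y0} ->
  exists d : {poly F}, [/\ (1 < size d)%N, d %| h & {in s, forall c, d %| c}].
Proof.
move=> h0 hy0 sy0; pose d := \big[@gcdp F/h]_(c <- s) c.
have dy0 : root (map_poly iL d) y0.
  rewrite /d big_seq; apply: (big_ind (fun p => root (map_poly iL p) y0)) => //.
  by move=> p r py0 ry0; rewrite gcdp_map root_gcd py0.
have [dh ds] : d %| h /\ {in s, forall c, d %| c}.
  rewrite /d; clear; elim: s => [|c s [IHh IHs]].
    by rewrite big_nil dvdpp.
  rewrite big_cons; split; first exact: dvdp_trans (dvdp_gcdr _ _) IHh.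
  move=> c'; rewrite inE => /predU1P[->|/IHs]; first exact: dvdp_gcdl.
  exact: dvdp_trans (dvdp_gcdr _ _).
exists d; split=> //; rewrite -(size_map_poly iL) (root_size_gt1 _ dy0) //.
by rewrite map_poly_eq0; apply: contraNneq h0 => d0; rewrite d0 dvd0p in dh.
Qed.

(** * Orders at 0 of univariate polynomials *)

Section ExactOrder.
Variable L : fieldType.
Implicit Types (p r : {poly L}) (k l N : nat).

Lemma dvdpX p : ('X %| p) = root p 0.
Proof. by rewrite -dvdp_XsubCl subr0. Qed.

Definition exact_order p k := ('X^k %| p) && ~~ ('X^(k.+1) %| p).

Lemma exact_orderE p k : exact_order p k = (p != 0) && (mup 0 p == k).
Proof.
rewrite /exact_order; have [->|p0] := eqVneq p 0; first by rewrite !dvdp0.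
have XE n : 'X^n = ('X - 0%:P) ^+ n :> {poly L} by rewrite subr0.
by rewrite !XE -mup_geq // -mup_leq // eqn_leq andbC.
Qed.

Lemma exact_orderM p r k l :
  exact_order p k -> exact_order r l -> exact_order (p * r) (k + l).
Proof.
rewrite !exact_orderE => /andP[p0 /eqP<-] /andP[r0 /eqP<-].
by rewrite mulf_neq0 // mupM /=.
Qed.

Lemma exact_order_uniq p k l : exact_order p k -> exact_order p l -> k = l.
Proof. by rewrite !exact_orderE => /andP[_ /eqP<-] /andP[_ /eqP]. Qed.

Lemma exact_order_congr p r k N :
  (k < N)%N -> 'X^N %| p - r -> exact_order p k = exact_order r k.
Proof.
move=> ltkN dvdN; have dvdE n : (n <= N)%N -> ('X^n %| p) = ('X^n %| r).
  move=> lenN; rewrite -[p](subrK r) dvdp_addr //.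
  exact: dvdp_trans (dvdp_exp2l _ lenN) dvdN.
by rewrite /exact_order !dvdE // ltnW.
Qed.

End ExactOrder.

(** * Evaluation of bivariate polynomials *)

Section BivariateEvaluation.
Variables (F K : fieldType) (iota : {rmorphism F -> K}) (x y : K).

Definition horner_y : {rmorphism {poly F} -> K} :=
  horner_eval y \o map_poly iota.

(** The evaluation [eval_xy] as a composite of ring morphisms, which makes it
    a morphism by inference. *)
Definition horner_xy : {rmorphism {poly {poly F}} -> K} :=
  horner_eval x \o map_poly horner_y.

Lemma eval_xyE g : eval_xy iota x y g = horner_xy g.
Proof.
rewrite /eval_xy -[RHS]/((map_poly horner_y g).[x]).
rewrite -[LHS]/(horner_eval y _.[x%:P]) -horner_map -map_poly_comp /=.
by rewrite /horner_eval hornerC.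
Qed.

Lemma horner_xyC c : horner_xy c%:P = horner_y c.
Proof. by rewrite -[LHS]/((map_poly horner_y c%:P).[x]) map_polyC hornerC. Qed.

Lemma horner_xyX : horner_xy 'X = x.
Proof. by rewrite -[LHS]/((map_poly horner_y 'X).[x]) map_polyX hornerX. Qed.

Lemma horner_yX : horner_y 'X = y.
Proof. by rewrite -[LHS]/((map_poly iota 'X).[y]) map_polyX hornerX. Qed.

Lemma horner_yC c : horner_y c%:P = iota c.
Proof. by rewrite -[LHS]/((map_poly iota c%:P).[y]) map_polyC hornerC. Qed.

End BivariateEvaluation.

(** * The function field as an extension of F(y) *)

Section FunctionField.
Variables (F K : fieldType) (iota : {rmorphism F -> K}) (x y : K).
Variables (q0 m : nat).
Hypothesis q0_gt1 : (1 < q0)%N.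
Hypothesis HK : is_function_field iota x y (curve_poly F q0 m).
Implicit Types (c h : {poly F}) (g : {poly {poly F}}).

Local Notation evalY := (horner_y iota y).
Local Notation evalXY := (horner_xy iota x y).

Lemma evalXY_eq0 g :
  evalXY g = 0 <-> exists h : {poly {poly F}}, g = curve_poly F q0 m * h.
Proof. by rewrite -eval_xyE; exact: eval_xy_ker HK g. Qed.

Lemma opp_curve_polyE : - curve_poly F q0 m = 'X^q0 + ('X - ('X^m)%:P).
Proof. by rewrite /curve_poly opprB polyC_exp addrA. Qed.

Lemma size_curve_tail : (size ('X - ('X^m)%:P : {poly {poly F}})%R < q0.+1)%N.
Proof. by rewrite size_XsubC ltnS. Qed.

Lemma size_opp_curve_poly : size (- curve_poly F q0 m) = q0.+1.
Proof. by rewrite opp_curve_polyE size_polyDl size_polyXn ?size_curve_tail. Qed.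

Lemma monic_opp_curve_poly : - curve_poly F q0 m \is monic.
Proof.
rewrite opp_curve_polyE monicE lead_coefDl ?lead_coefXn //.
by rewrite size_polyXn size_curve_tail.
Qed.

Lemma curve_eq : x ^+ q0 + x = y ^+ m.
Proof.
have /evalXY_eq0 : exists h : {poly {poly F}},
    curve_poly F q0 m = curve_poly F q0 m * h by exists 1; rewrite mulr1.
move=> /eqP; rewrite -oppr_eq0 -rmorphN opp_curve_polyE rmorphD rmorphB.
rewrite rmorphXn horner_xyX horner_xyC rmorphXn horner_yX addrA subr_eq0.
by move/eqP.
Qed.

(** The powers 1, X, ..., X^(q0 - 1) are linearly independent over F[Y],
    since the equation of the curve is monic of degree q0 in X. *)
Lemma evalXY_inj g : (size g <= q0)%N -> evalXY g = 0 -> g = 0.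
Proof.
move=> sg /evalXY_eq0[h]; rewrite -mulrNN => gE.
apply/eqP; apply: contraTT sg => g0; rewrite -ltnNge gE.
have h0 : - h != 0 by apply: contraNneq g0; rewrite gE => ->; rewrite mulr0.
rewrite size_monicM ?monic_opp_curve_poly // size_opp_curve_poly addSn /=.
by rewrite -{1}[q0]addn0 ltn_add2l size_poly_gt0.
Qed.

Lemma evalY_eq0 h : evalY h = 0 -> h = 0.
Proof.
rewrite -(horner_xyC iota x) => /evalXY_inj h0.
apply/eqP; rewrite -polyC_eq0 h0 //.
exact: leq_trans (size_polyC_leq1 _) (ltnW q0_gt1).
Qed.

Lemma x_neq0 : x != 0.
Proof.
apply/eqP; rewrite -(horner_xyX iota x y) => /evalXY_inj.
by rewrite size_polyX => /(_ q0_gt1)/eqP; rewrite polyX_eq0.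
Qed.

Lemma y_neq0 : y != 0.
Proof.
apply/eqP; rewrite -(horner_yX iota y) => /evalY_eq0 /eqP.
by rewrite polyX_eq0.
Qed.

Lemma evalXY_reduce g :
  exists2 r : {poly {poly F}}, (size r <= q0)%N & evalXY r = evalXY g.
Proof.
have mon := monic_opp_curve_poly.
exists (Pdiv.CommonRing.rmodp g (- curve_poly F q0 m)).
  rewrite -ltnS -size_opp_curve_poly Pdiv.CommonRing.ltn_rmodp.
  exact: monic_neq0.
rewrite [in RHS](Pdiv.RingMonic.rdivp_eq mon g) rmorphD.
have /evalXY_eq0-> : exists h : {poly {poly F}},
    Pdiv.CommonRing.rdivp g (- curve_poly F q0 m) * - curve_poly F q0 m
      = curve_poly F q0 m * h.
  by eexists; rewrite mulrN mulrC -mulrN.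
by rewrite add0r.
Qed.

(** The function field is algebraic over F(y): each nonzero element of
    F[x, y] is integral over F[y], and divides the nonzero coefficient of
    lowest degree of an equation that it satisfies. *)
Lemma evalXY_dvd_evalY g : evalXY g != 0 ->
  exists2 h : {poly F}, h != 0 &
    exists g' : {poly {poly F}}, evalXY g * evalXY g' = evalY h.
Proof.
move=> g0; have intC c : integralOver evalY (evalY c) by exact: integral_id.
have intx : integralOver evalY x.
  exists (- curve_poly F q0 m); first exact: monic_opp_curve_poly.
  rewrite /root -[_.[x]]/(evalXY _) rmorphN oppr_eq0; apply/eqP/evalXY_eq0.
  by exists 1; rewrite mulr1.
have [p p_mon] : integralOver evalY (evalXY g).
  apply: integral_horner => //; apply/integral_poly => i; rewrite coef_map.
  exact: intC.
move: (monic_neq0 p_mon).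
elim/poly_ind: p {p_mon} => [|p c IHp]; rewrite ?eqxx //.
move=> pc0 /rootP.
have -> : map_poly evalY (p * 'X + c%:P) =
    map_poly evalY p * 'X + (evalY c)%:P.
  by rewrite rmorphD rmorphM /= map_polyX map_polyC.
rewrite hornerMXaddC.
have [c0 /eqP|c0 /eqP] := eqVneq c 0.
  rewrite c0 rmorph0 addr0 mulf_eq0 (negbTE g0) orbF; apply: IHp.
  by apply: contraNneq pc0 => ->; rewrite c0 mul0r add0r.
rewrite addr_eq0 => /eqP pg; exists (- c); first by rewrite oppr_eq0.
exists (map_poly polyC p).[g]; rewrite rmorphN -pg mulrC.
rewrite -(horner_map evalXY) -map_poly_comp.
congr (_.[_] * _); apply: eq_map_poly => d; exact: horner_xyC.
Qed.

(** The denominator of any fraction can be moved into F[y]: the powers of x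
    below q0 span K over F(y). *)
Lemma normal_form (z : K) : exists (h : {poly F}) (g : {poly {poly F}}),
  [/\ h != 0, (size g <= q0)%N & z * evalY h = evalXY g].
Proof.
have [g [k []]] := eval_xy_frac HK z; rewrite !eval_xyE => k0 ->.
have [h h0 [k' kk']] := evalXY_dvd_evalY k0.
have [r rs rE] := evalXY_reduce (g * k').
exists h, r; split=> //; rewrite rE -kk' mulrA divfK //.
by rewrite rmorphM.
Qed.

(** * Poles of x *)

Section PolesOfX.
Hypotheses (m_gt0 : (0 < m)%N) (co_mq0 : coprime m q0).
Implicit Types P Q : point iota.

Lemma evalY_coef h n :
  (size h <= n)%N -> evalY h = \sum_(j < n) iota h`_j * y ^+ j.
Proof.
move=> sh; rewrite -[LHS]/((map_poly iota h).[y]).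
rewrite (horner_coef_wide _ (_ : _ <= n)%N).
  by apply: eq_bigr => j _; rewrite coef_map.
by rewrite size_map_poly.
Qed.

Definition monomials g :=
  [seq ij : 'I_q0 * 'I_(sizeY g) <- enum {: 'I_q0 * 'I_(sizeY g)}
    | g`_ij.1`_ij.2 != 0].

Lemma evalXY_sum g : (size g <= q0)%N ->
  evalXY g =
    \sum_(ij <- monomials g)
      iota g`_ij.1`_ij.2 * (x ^+ ij.1 * y ^+ ij.2).
Proof.
move=> sg; rewrite big_filter big_enum_cond /= big_rmcond; last first.
  by move=> ij /negPn/eqP->; rewrite rmorph0 mul0r.
rewrite -(pair_bigA _ (fun (i : 'I_q0) (j : 'I_(sizeY g)) =>
  iota g`_i`_j * (x ^+ i * y ^+ j))) /=.
rewrite -[LHS]/((map_poly evalY g).[x]) (horner_coef_wide _ (_ : _ <= q0)%N).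
  apply: eq_bigr => i _.
  transitivity (evalY g`_i * x ^+ i); first by rewrite coef_map.
  rewrite (evalY_coef (max_size_coefXY g i)) mulr_suml.
  by apply: eq_bigr => j _; rewrite -mulrA [_ ^+ _ * x ^+ _]mulrC.
exact: leq_trans (size_poly _ _) sg.
Qed.

(** The monomials x^i y^j with i < q0 have pairwise different orders because m
    and q0 are coprime.  The last clause determines i m + j q0 from g alone,
    which makes the order the same at all such points. *)
Lemma ord_evalXY P (k : nat) g :
    (0 < k)%N -> P x = - (m * k)%:Z -> P y = - (q0 * k)%:Z ->
    (size g <= q0)%N -> g != 0 ->
  exists i j : nat, [/\ g`_i`_j != 0,
    P (evalXY g) = - ((i * m + j * q0) * k)%:Z &
    forall i' j', g`_i'`_j' != 0 -> (i' * m + j' * q0 <= i * m + j * q0)%N].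
Proof.
move=> k_gt0 Px Py sg g0; have q0_gt0 := ltnW q0_gt1.
have [x0 y0] := (x_neq0, y_neq0).
set s := monomials g; pose E (ij : 'I_q0 * 'I_(sizeY g)) :=
  iota g`_ij.1`_ij.2 * (x ^+ ij.1 * y ^+ ij.2).
have EgS : evalXY g = \sum_(ij <- s) E ij by exact: evalXY_sum.
have E0 : {in s, forall ij, E ij != 0}.
  move=> ij; rewrite mem_filter => /andP[gij _].
  by rewrite /E !mulf_neq0 ?expf_neq0 ?fmorph_eq0.
have PE : {in s, forall ij, P (E ij) = - ((ij.1 * m + ij.2 * q0) * k)%:Z}.
  move=> ij; rewrite mem_filter => /andP[gij _].
  rewrite /E ordM ?mulf_neq0 ?expf_neq0 ?fmorph_eq0 // ord_const // add0r.
  rewrite ordM ?expf_neq0 // !ordX // Px Py; lia.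
have us : uniq [seq P (E ij) | ij <- s].
  rewrite map_inj_in_uniq ?(filter_uniq _ (enum_uniq _)) // => ij ij' sij sij'.
  rewrite !PE // => /oppr_inj[] /eqP; rewrite eqn_pmul2r // => /eqP Eij.
  have [/val_inj Ei /val_inj Ej] :=
    lin_comb_inj co_mq0 q0_gt0 (ltn_ord _) (ltn_ord _) Eij.
  by case: ij ij' {sij sij' Eij} Ei Ej => [? ?] [? ?] /= -> ->.
have s0 : s != [::].
  apply: contraNneq g0 => s_nil; apply/eqP/evalXY_inj => //.
  by rewrite EgS s_nil big_nil.
have [_ [ij sij [PS minP]]] := ord_sum_uniq s0 E0 us.
exists ij.1, ij.2; split.
- by move: sij; rewrite mem_filter => /andP[].
- by rewrite EgS PS PE.
move=> i' j' gij'; have lt_i' : (i' < q0)%N.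
  rewrite (leq_trans _ sg) // ltnNge.
  by apply: contraNN gij' => /(nth_default 0)->; rewrite coef0.
have lt_j' : (j' < sizeY g)%N.
  rewrite (leq_trans _ (max_size_coefXY g i')) // ltnNge.
  by apply: contraNN gij' => /(nth_default 0)->.
have s' : (Ordinal lt_i', Ordinal lt_j') \in s.
  by rewrite mem_filter mem_enum gij'.
have := minP _ s'; rewrite !PE //= lerN2 lez_nat leq_pmul2r //.
Qed.

(** The curve equation forces m P(y) = q0 P(x), so (P x, P y) is a multiple
    k > 0 of (- m, - q0).  Then k divides every value of P, and k = 1 because
    P is normalized. *)
Lemma ord_xy P : P x < 0 -> P x = - m%:Z /\ P y = - q0%:Z.
Proof.
move=> Px; have [x0 y0] := (x_neq0, y_neq0); have xq0 := expf_neq0 q0 x0.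
have lt_xq : P (x ^+ q0) < P x by rewrite ordX //; nia.
have [_] := ordD_lt xq0 x0 lt_xq; rewrite curve_eq !ordX // => Pyx.
have /dvdzP[c Px_c] : (m %| P x)%Z.
  have co_z : coprimez m q0 by rewrite coprimezE.
  by rewrite -(Gauss_dvdzl _ co_z); apply/dvdzP; exists (P y).
have [k k_gt0 Px_k] : exists2 k : nat, (0 < k)%N & P x = - (m * k)%:Z.
  by exists `|c|%N; nia.
have Py_k : P y = - (q0 * k)%:Z by nia.
suffices k1 : k = 1%N by rewrite Px_k Py_k k1 !muln1.
have dvdk g : (size g <= q0)%N -> g != 0 ->
    exists n : nat, P (evalXY g) = - (n * k)%:Z.
  move=> sg g0; have [i [j [_ Pg _]]] := ord_evalXY k_gt0 Px_k Py_k sg g0.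
  by exists (i * m + j * q0)%N.
have [t t0 Pt] := ord_normalized P; have [h [g [h0 sg tE]]] := normal_form t.
have th0 : evalXY g != 0.
  by rewrite -tE mulf_neq0 //; apply: contraNneq h0 => /evalY_eq0->.
have g0 : g != 0 by apply: contraNneq th0 => ->; rewrite rmorph0.
have hY0 : evalY h != 0 by apply: contraNneq h0 => /evalY_eq0->.
have [n Pg] := dvdk g sg g0.
have [||n' Ph] := dvdk h%:P; rewrite ?polyC_eq0 //.
  exact: leq_trans (size_polyC_leq1 _) (ltnW q0_gt1).
move: Pg; rewrite -tE ordM // Pt -(horner_xyC iota x) Ph => Pg.
have kn : (n' * k = n * k + 1)%N by lia.
have : (k %| n * k + 1)%N by rewrite -kn dvdn_mull.
by rewrite dvdn_addr ?dvdn_mull // dvdn1 => /eqP.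
Qed.

(** Hence the orders on F[x, y], and then on its fraction field, are the same
    at all poles of x: there is only one. *)
Lemma pole_x_uniq P Q : P x < 0 -> Q x < 0 -> P =1 Q.
Proof.
move=> /ord_xy[Px Py] /ord_xy[Qx Qy] z.
have PQ g : (size g <= q0)%N -> g != 0 -> P (evalXY g) = Q (evalXY g).
  move=> sg g0.
  have [|||i [j [gij -> maxP]]] := @ord_evalXY P 1 g _ _ _ sg g0;
    rewrite ?muln1 //.
  have [|||i' [j' [gij' -> maxQ]]] := @ord_evalXY Q 1 g _ _ _ sg g0;
    rewrite ?muln1 //.
  by congr (- Posz _); apply/eqP; rewrite eqn_leq maxP ?maxQ.
have [->|z0] := eqVneq z 0; first by rewrite !Defs.ord0.
have [h [g [h0 sg zE]]] := normal_form z.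
have hY0 : evalY h != 0 by apply: contraNneq h0 => /evalY_eq0->.
have g0 : g != 0.
  apply: contraNneq (mulf_neq0 z0 hY0) => g0.
  by rewrite zE g0 rmorph0.
have := PQ g sg g0; rewrite -zE !ordM // -(horner_xyC iota x).
rewrite (PQ h%:P) ?polyC_eq0 //.
  exact: addIr.
exact: leq_trans (size_polyC_leq1 _) (ltnW q0_gt1).
Qed.

End PolesOfX.

(** * The point at a solution in a finite extension *)

Section PlanePoint.
Variables (L : finFieldType) (iL : {rmorphism F -> L}) (x0 y0 : L).
Hypothesis q0_char : [pchar L].-nat q0.
Hypothesis on_curve : x0 ^+ q0 + x0 = y0 ^+ m.

(** The N-th approximation of the branch through (x0, y0), that is, of X as a
    power series in t = Y - y0: since the derivative in X of the equation is
    constant, Newton iteration is the fixed point iteration of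
    X = Y ^ m - X ^ q0. *)
Fixpoint branch N : {poly L} :=
  if N is N'.+1 then ('X + y0%:P) ^+ m - branch N' ^+ q0 else x0%:P.

Definition expandY : {rmorphism {poly F} -> {poly L}} :=
  comp_poly ('X + y0%:P) \o map_poly iL.

Definition expand N : {rmorphism {poly {poly F}} -> {poly L}} :=
  horner_eval (branch N) \o map_poly expandY.

Definition defect N := branch N ^+ q0 + branch N - ('X + y0%:P) ^+ m.

Lemma q0_pchar_poly : [pchar {poly L}].-nat q0.
Proof. by rewrite (eq_pnat _ (pchar_poly L)). Qed.

Lemma branchS N : branch N.+1 = branch N - defect N.
Proof. by rewrite /= /defect; ring. Qed.

(** Frobenius turns the fixed point iteration into one that raises the defect
    to the power q0, so that the defect tends to 0 in the t-adic topology. *)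
Lemma defectS N : defect N.+1 = - defect N ^+ q0.
Proof.
rewrite {1}/defect branchS exprDn_pchar ?exprNn_pchar ?q0_pchar_poly //.
by rewrite {2}/defect; ring.
Qed.

Lemma dvdp_defect N : 'X^(N.+1) %| defect N.
Proof.
elim: N => [|N IHN]; last first.
  rewrite defectS dvdpNr; apply: dvdp_trans (dvdp_exp2r q0 IHN).
  rewrite -exprM dvdp_exp2l // (leq_trans _ (leq_mul (leqnn N.+1) q0_gt1)) //.
  by rewrite muln2 -addnn addSn ltnS leq_addl.
by rewrite expr1 dvdpX /root /defect /= !hornerE on_curve subrr.
Qed.

Lemma expandC N c : expand N c%:P = expandY c.
Proof.
by rewrite -[LHS]/((map_poly expandY c%:P).[branch N]) map_polyC hornerC.
Qed.

Lemma expandX N : expand N 'X = branch N.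
Proof.
by rewrite -[LHS]/((map_poly expandY 'X).[branch N]) map_polyX hornerX.
Qed.

Lemma expandYX : expandY 'X = 'X + y0%:P.
Proof.
by rewrite -[LHS]/(map_poly iL 'X \Po _) map_polyX comp_polyX.
Qed.

Lemma expandYC (a : F) : expandY a%:P = (iL a)%:P.
Proof.
by rewrite -[LHS]/(map_poly iL a%:P \Po _) map_polyC comp_polyC.
Qed.

Lemma expandY_eq0 h : (expandY h == 0) = (h == 0).
Proof.
rewrite -[expandY h]/(map_poly iL h \Po _) comp_poly2_eq0 ?map_poly_eq0 //.
by rewrite size_XaddC.
Qed.

Lemma expand_curve N : expand N (curve_poly F q0 m) = - defect N.
Proof.
rewrite -[curve_poly _ _ _]opprK opp_curve_polyE rmorphN rmorphD rmorphB.
by rewrite rmorphXn expandX expandC rmorphXn expandYX addrA.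
Qed.

Lemma dvdp_branch M N : (N <= M)%N -> 'X^(N.+1) %| branch M - branch N.
Proof.
elim: M => [|M IHM]; first by rewrite leqn0 => /eqP->; rewrite subrr dvdp0.
rewrite leq_eqVlt => /predU1P[->|leNM]; first by rewrite subrr dvdp0.
rewrite branchS addrAC dvdp_addr ?IHM // dvdpNr.
by apply: dvdp_trans (dvdp_defect M); rewrite dvdp_exp2l.
Qed.

Lemma dvdp_expand M N g : (N <= M)%N -> 'X^(N.+1) %| expand M g - expand N g.
Proof.
move=> leNM.
(* branch M - branch N divides p(branch M) - p(branch N). *)
set p := map_poly expandY g.
rewrite -[expand M g]/(p.[_]) -[expand N g]/(p.[_]).
have /factor_theorem[u pE] : root (p - (p.[branch N])%:P) (branch N).
  by rewrite /root !hornerE subrr.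
have := congr1 (horner^~ (branch M)) pE; rewrite !hornerE => ->.
by rewrite dvdp_mull ?dvdp_branch.
Qed.

(** Stage k of the expansion determines the coefficients up to t ^ k, so this
    says that the power series g(X(t), y0 + t) has order k. *)
Definition has_order g k := exact_order (expand k g) k.

Lemma has_orderE N g k :
  (k <= N)%N -> has_order g k = exact_order (expand N g) k.
Proof.
by move=> lekN; rewrite (exact_order_congr (leqnn _) (dvdp_expand g lekN)).
Qed.

Lemma has_order_uniq g k l : has_order g k -> has_order g l -> k = l.
Proof.
rewrite (has_orderE g (leq_maxl k l)) (has_orderE g (leq_maxr k l)).
exact: exact_order_uniq.
Qed.

Lemma has_orderM g g' k l :
  has_order g k -> has_order g' l -> has_order (g * g') (k + l).
Proof.
rewrite (has_orderE g (leq_addr l k)) (has_orderE g' (leq_addl k l)).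
by rewrite /has_order rmorphM; exact: exact_orderM.
Qed.

Lemma has_orderD g g' k l r : has_order g k -> has_order g' l ->
  has_order (g + g') r -> (minn k l <= r)%N.
Proof.
pose N := (k + l + r)%N; have [leNk leNl leNr] : [/\ k <= N, l <= N & r <= N]%N.
  by rewrite /N; split; lia.
rewrite (has_orderE _ leNk) (has_orderE _ leNl) (has_orderE _ leNr) rmorphD.
case/andP=> gk _ /andP[gl _] /andP[_]; apply: contraNleq => lt_r.
by rewrite dvdp_add // (dvdp_trans _ gk, dvdp_trans _ gl) // dvdp_exp2l; lia.
Qed.

(** The expansion is compatible with the relation of the curve only up to the
    defect, which is why equality in K is seen as a congruence at each stage. *)
Lemma dvdp_expand_eq g g' N : evalXY g = evalXY g' ->
  'X^(N.+1) %| expand N g - expand N g'.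
Proof.
move=> /eqP; rewrite -subr_eq0 -rmorphB => /eqP/evalXY_eq0[u gE].
by rewrite -rmorphB gE rmorphM expand_curve mulNr dvdpNr dvdp_mulr ?dvdp_defect.
Qed.

Lemma has_order_eq g g' k :
  evalXY g = evalXY g' -> has_order g k = has_order g' k.
Proof. by move=> /(dvdp_expand_eq k); exact: exact_order_congr. Qed.

Lemma has_order_neq0 g k : has_order g k -> evalXY g != 0.
Proof.
apply: contraTneq; rewrite -(rmorph0 evalXY) => /has_order_eq->.
by rewrite /has_order exact_orderE rmorph0 eqxx.
Qed.

(** An element of F[x, y] divides a nonzero polynomial in y, whose expansion
    is a nonzero polynomial in t, so its own expansion does not vanish. *)
Lemma has_order_exists g : evalXY g != 0 -> exists k, has_order g k.
Proof.
move=> /evalXY_dvd_evalY[h h0 [g' gg']]; pose N := size (expandY h).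
have ndvd : ~~ ('X^(N.+1) %| expand N g).
  have nz : expandY h != 0 by rewrite expandY_eq0.
  apply/negP => dvdg; have : 'X^(N.+1) %| expandY h.
    rewrite -(expandC N) -[X in _ %| X](subrK (expand N (g * g'))).
    rewrite dvdp_add ?dvdp_expand_eq ?horner_xyC ?rmorphM //.
    by rewrite dvdp_mulr.
  by move=> /(dvdp_leq nz); rewrite size_polyXn ltnNge leqnSn.
have gN0 : expand N g != 0 by apply: contraNneq ndvd => ->; rewrite dvdp0.
exists (mup 0 (expand N g)).
rewrite (@has_orderE N) ?exact_orderE ?gN0 ?eqxx //.
by rewrite mup_leq // subr0.
Qed.

Lemma expand_horner0 N g : (expand N g).[0] = horner_xy iL x0 y0 g.
Proof.
have b0 M : (branch M).[0] = x0.
  elim: M => [|M IHM] /=; first by rewrite hornerC.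
  by rewrite !hornerE IHM ?add0r -on_curve addrAC subrr add0r.
have Y0 c : (expandY c).[0] = horner_y iL y0 c.
  by rewrite -[expandY c]/(map_poly iL c \Po _) horner_comp !hornerE ?add0r.
rewrite -[expand N g]/((map_poly expandY g).[_]).
rewrite -[LHS]/(horner_eval 0 _) -(horner_map (horner_eval 0)) -map_poly_comp.
rewrite /= /horner_eval b0 -[RHS]/((map_poly (horner_y iL y0) g).[x0]).
congr (_.[_]); apply: eq_map_poly => c; exact: Y0.
Qed.

Lemma has_order_gt0 g k :
  has_order g k -> (0 < k)%N = (horner_xy iL x0 y0 g == 0).
Proof.
rewrite /has_order exact_orderE => /andP[gk0 /eqP<-].
set p := expand k g in gk0 *; rewrite -(expand_horner0 k) -/p -XsubC_dvd //.
by rewrite dvdp_XsubCl.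
Qed.

(** Each element of L is a simple root of X ^ |L| - X, so this polynomial in
    y is a uniformizer at (x0, y0). *)
Lemma has_order_uniformizer : has_order ('X^#|L| - 'X)%:P 1.
Proof.
rewrite /has_order expandC rmorphB rmorphXn.
rewrite expandYX; have -> : ('X + y0%:P) ^+ #|L| - ('X + y0%:P) =
    ('X^#|L| - 'X) \Po ('X + y0%:P) :> {poly L}.
  by rewrite comp_polyB comp_Xn_poly comp_polyX.
rewrite finField_genPoly (bigD1 y0) //=.
rewrite comp_polyM comp_polyB comp_polyX comp_polyC.
rewrite addrK -[1%N]addn0; apply: exact_orderM.
  rewrite exact_orderE polyX_eq0 /= -[X in mup _ X]subr0 -(polyC0 L).
  by rewrite -[X in mup _ X]expr1 mup_XsubCX eqxx.
rewrite /exact_order expr0 dvd1p expr1 dvdpX /root horner_comp horner_prod.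
apply/prodf_neq0 => z zy0.
by rewrite !hornerE ?add0r subr_eq0 eq_sym.
Qed.

(** The order of vanishing along the branch is a valuation on F[x, y], and it
    extends to quotients. *)
Lemma plane_point_exists : exists Q : point iota, forall g, evalXY g != 0 ->
  0 <= Q (evalXY g) /\ (0 < Q (evalXY g)) = (horner_xy iL x0 y0 g == 0).
Proof.
pose rep z (w : ({poly {poly F}} * {poly {poly F}}) * (nat * nat)) :=
  [&& has_order w.1.1 w.2.1, has_order w.1.2 w.2.2 &
      z * evalXY w.1.2 == evalXY w.1.1].
(* The alternative z == 0 makes the choice of a representation total. *)
have rep_ex (z : K) : exists w, (z == 0) || rep z w.
  have [_|z0] /= := eqVneq z 0; first by exists (0, 0, (0%N, 0%N)).
  have [h [g [h0 _ zE]]] := normal_form z.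
  have hY0 : evalY h != 0 by apply: contraNneq h0 => /evalY_eq0->.
  have [|k gk] := @has_order_exists g; first by rewrite -zE mulf_neq0.
  have [|l hl] := @has_order_exists h%:P; first by rewrite horner_xyC.
  by exists (g, h%:P, (k, l)); apply/and3P; split=> //; rewrite horner_xyC zE.
pose v (z : K) : int := let w := sval (sigW (rep_ex z)) in
  if z == 0 then 0 else w.2.1%:Z - w.2.2%:Z.
have vE (z : K) g (h : {poly {poly F}}) k l :
    z != 0 -> has_order g k -> has_order h l -> z * evalXY h = evalXY g ->
  v z = k%:Z - l%:Z.
  move=> z0 gk hl zE; rewrite /v; case: sigW => [[[g' h'] [k' l']]].
  rewrite (negbTE z0) /= => /and3P[gk' hl' /eqP].
  rewrite -/evalXY [fst _]/= [snd _]/= => zE'.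
  have gh : evalXY (g * h') = evalXY (g' * h).
    by rewrite !rmorphM -zE -zE'; ring.
  have := has_orderM gk' hl; rewrite -(has_order_eq _ gh).
  by move=> /(has_order_uniq (has_orderM gk hl')) /=; lia.
have v_rep (z : K) : z != 0 -> exists g (h : {poly {poly F}}) k l,
    [/\ has_order g k, has_order h l, z * evalXY h = evalXY g &
        v z = k%:Z - l%:Z].
  move=> z0; have [[[g h] [k l]]] := rep_ex z.
  rewrite (negbTE z0) /= => /and3P[gk hl /eqP zE].
  by exists g, h, k, l; rewrite (vE _ _ _ _ _ z0 gk hl zE).
have order1 : has_order 1 0.
  rewrite /has_order rmorph1 exact_orderE oner_eq0 mupNroot //.
  by rewrite /root hornerC oner_eq0.
have v_eval g k : has_order g k -> v (evalXY g) = k%:Z.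
  move=> gk; rewrite (vE _ g 1 k 0%N) ?(has_order_neq0 gk) ?subr0 //.
  by rewrite rmorph1 mulr1.
have v0 : v 0 = 0 by rewrite /v; case: sigW; rewrite eqxx.
have vM z w : z != 0 -> w != 0 -> v (z * w) = v z + v w.
  move=> z0 w0; have [g [h [k [l [gk hl zE ->]]]]] := v_rep z z0.
  have [g' [h' [k' [l' [gk' hl' wE ->]]]]] := v_rep w w0.
  rewrite (vE _ _ _ _ _ _ (has_orderM gk gk') (has_orderM hl hl'));
    rewrite ?mulf_neq0 //.
    by clear; lia.
  by rewrite !rmorphM -zE -wE; ring.
have vD z w : z != 0 -> w != 0 -> z + w != 0 ->
    Num.min (v z) (v w) <= v (z + w).
  move=> z0 w0 zw0; have [g [h [k [l [gk hl zE ->]]]]] := v_rep z z0.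
  have [g' [h' [k' [l' [gk' hl' wE ->]]]]] := v_rep w w0.
  have hh := has_orderM hl hl'.
  have sumE : (z + w) * evalXY (h * h') = evalXY (g * h' + g' * h).
    by rewrite rmorphD !rmorphM -zE -wE; ring.
  have [|r sr] := @has_order_exists (g * h' + g' * h).
    by rewrite -sumE mulf_neq0 // (has_order_neq0 hh).
  rewrite (vE _ _ _ _ _ zw0 sr hh sumE).
  have := has_orderD (has_orderM gk hl') (has_orderM gk' hl) sr.
  by clear; lia.
have v_const (c : F) : c != 0 -> v (iota c) = 0.
  move=> c0; have oc : has_order c%:P%:P 0.
    rewrite /has_order expandC expandYC exact_orderE polyC_eq0 fmorph_eq0 c0.
    by rewrite mupNroot // /root hornerC fmorph_eq0.
  by rewrite -(horner_yC iota y) -(horner_xyC iota x) (v_eval _ _ oc).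
have v_norm : exists2 t : K, t != 0 & v t = 1.
  have o1 := has_order_uniformizer.
  exists (evalXY ('X^#|L| - 'X)%:P); first exact: has_order_neq0 o1.
  by rewrite (v_eval _ 1%N).
exists (Point v0 vM vD v_const v_norm) => g /has_order_exists[k gk] /=.
by rewrite (v_eval _ _ gk) ltz_nat (has_order_gt0 gk).
Qed.

End PlanePoint.

End FunctionField.

(** * Functions with poles only at infinity *)

Section FiniteConstants.
Variables (F : finFieldType) (K : fieldType) (iota : {rmorphism F -> K}).
Variables (x y : K) (q0 m : nat).
Hypotheses (q0_gt1 : (1 < q0)%N) (m_gt0 : (0 < m)%N).
Hypothesis q0_char : [pchar F].-nat q0.
Hypothesis HK : is_function_field iota x y (curve_poly F q0 m).

(** F[x, y] is integrally closed.  If z = g(x, y) / h(y) is regular at all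
    points over a root y0 of h, then g(X, y0), of degree less than q0, vanishes
    at all the q0 solutions of X ^ q0 + X = y0 ^ m, so y0 is a common root of h
    and of the coefficients of g and the fraction simplifies. *)
Lemma regular_off_poles_polynomial (z : K) :
    (forall Q : point iota, 0 <= Q x -> regular_at Q z) ->
  exists2 g : {poly {poly F}}, (size g <= q0)%N & z = horner_xy iota x y g.
Proof.
move=> z_reg; have [->|z0] := eqVneq z 0.
  by exists 0; rewrite ?size_poly0 ?rmorph0.
have [h [g [h0 sg zE]]] := normal_form q0_gt1 HK z.
have [n] := ubnP (size h); elim: n h g h0 sg zE => // n IHn h g h0 sg zE.
rewrite ltnS => le_hn; have [h_le1|h_gt1] := leqP (size h) 1.
  have hE := size1_polyC h_le1; set c := h`_0 in hE.
  have c0 : c != 0 by rewrite -polyC_eq0 -hE.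
  exists ((c^-1)%:P%:P * g).
    by rewrite mul_polyC (leq_trans (size_scale_leq _ _)).
  rewrite rmorphM -zE horner_xyC hE !horner_yC fmorphV mulrC mulfK //.
  by rewrite fmorph_eq0.
have [L [iL [y0 [s [hy0 us ss sP]]]]] := exists_fibre m q0_gt1 q0_char h_gt1.
have charL : [pchar L].-nat q0 by rewrite (eq_pnat _ (fmorph_pchar iL)).
have hY0 : horner_y iota y h != 0.
  by apply: contraNneq h0 => /(evalY_eq0 q0_gt1 HK)->.
have hXY0 : horner_xy iota x y h%:P != 0 by rewrite horner_xyC.
have gXY0 : horner_xy iota x y g != 0 by rewrite -zE mulf_neq0.
have g_x0 x0 : x0 \in s -> horner_xy iL x0 y0 g = 0.
  move=> /sP on_curve; apply/eqP.
  have [Q QP] := plane_point_exists q0_gt1 HK iL charL on_curve.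
  have [_ <-] := QP g gXY0; have [_] := QP _ hXY0.
  rewrite !horner_xyC -[horner_y iL y0 h]/((map_poly iL h).[y0]).
  rewrite (rootP hy0) eqxx => Qh.
  have /z_reg : 0 <= Q x.
    have := QP 'X; rewrite !horner_xyX => /(_ (x_neq0 q0_gt1 HK))[].
    by [].
  rewrite {1}/regular_at (negbTE z0) orFb => Qz.
  by rewrite -zE ordM // ltr_wpDl.
have g_y0 : {in (g : seq _), forall c, root (map_poly iL c) y0}.
  have g0 : map_poly (horner_y iL y0) g = 0.
    apply: (roots_geq_poly_eq0 _ us); last first.
      by rewrite ss (leq_trans (size_poly _ _)).
    by apply/allP => x0 /g_x0/eqP.
  move=> _ /(nthP 0)[i _ <-]; rewrite /root -[_.[y0]]/(horner_y iL y0 g`_i).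
  by rewrite -[horner_y _ _ _](coef_map (horner_y iL y0)) g0 coef0.
have [d [d_gt1 dh dg]] := exists_common_divisor h0 hy0 g_y0.
pose g' := map_poly (fun c => c %/ d) g.
have gE : g = d%:P * g'.
  apply/polyP => i; rewrite coefCM coef_map_id0 ?div0p // mulrC divpK //.
  have [lt_ig|le_gi] := ltnP i (size g); first exact/dg/mem_nth.
  by rewrite nth_default ?dvdp0.
have d0 : d != 0 by rewrite -size_poly_gt0 ltnW.
have h'0 : h %/ d != 0.
  by rewrite divp_eq0 (negbTE h0) (negbTE d0) ltnNge dvdp_leq.
apply: (IHn (h %/ d) g') => //.
- exact: leq_trans (size_poly _ _) sg.
- have dY0 : horner_y iota y d != 0.
    by apply: contraNneq d0 => /(evalY_eq0 q0_gt1 HK)->.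
  apply: (mulfI dY0); rewrite -(horner_xyC iota x y d) -rmorphM -gE -zE.
  by rewrite horner_xyC mulrCA -rmorphM [d * _]mulrC divpK.
rewrite size_divp // (leq_trans _ le_hn) // ltn_subrL size_poly_gt0 h0 andbT.
by rewrite -subn1 subn_gt0.
Qed.

Lemma weierstrass_semigroup_pole (P : point iota) (n : nat) :
    coprime m q0 -> P x < 0 -> weierstrass_semigroup P n <->
  numerical_semigroup2 m q0 n.
Proof.
move=> co_mq0 Px; have [Pxm Pyq] := ord_xy q0_gt1 HK m_gt0 co_mq0 Px.
have x0 := x_neq0 q0_gt1 HK; have y0 := y_neq0 q0_gt1 HK.
split=> [[z z0 zP]|[i [j nE]]].
  have [Q Qx|g sg zE] := @regular_off_poles_polynomial z.
    have [_ ] := zP Q; rewrite /pole_order /regular_at (negbTE z0) /=.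
    move=> QP; have : Num.max 0 (- Q z) = 0.
      by apply: QP => QP; rewrite QP leNgt Px in Qx.
    by lia.
  have g0 : g != 0 by apply: contraNneq z0 => g0; rewrite zE g0 rmorph0.
  have Px1 : P x = - (m * 1)%:Z by rewrite muln1.
  have Py1 : P y = - (q0 * 1)%:Z by rewrite muln1.
  have [i [j [_ Pg _]]] :=
    ord_evalXY q0_gt1 HK m_gt0 co_mq0 (ltn0Sn 0) Px1 Py1 sg g0.
  have [Pn _] := zP P; exists i, j; have := Pn (fun=> erefl).
  by rewrite /pole_order zE Pg; lia.
exists (x ^+ i * y ^+ j); first by rewrite mulf_neq0 ?expf_neq0.
have oE (Q : point iota) : Q (x ^+ i * y ^+ j) = Q x * i%:Z + Q y * j%:Z.
  by rewrite ordM ?expf_neq0 // !ordX.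
move=> Q; rewrite /pole_order oE; split=> [QP|QP].
  by rewrite !QP Pxm Pyq nE; lia.
have Qx : 0 <= Q x.
  rewrite leNgt; apply/negP => Qx; apply: QP.
  exact: (pole_x_uniq q0_gt1 HK m_gt0 co_mq0 Qx Px).
have Qy : 0 <= Q y.
  have : regular_at Q (y ^+ m).
    have xQ : regular_at Q x by rewrite /regular_at Qx orbT.
    by rewrite -(curve_eq HK) regularD ?regularX.
  rewrite /regular_at expf_eq0 (negbTE y0) andbF /= ordX // pmulr_lge0 //.
by nia.
Qed.

End FiniteConstants.

Theorem proposition6p2 (F : finFieldType) (p e q0 q m : nat)
    (p_prime : prime p) (e_gt0 : (0 < e)%N) (q0_def : q0 = (p ^ e)%N)
    (q_def : q = (q0 ^ 2)%N) (card_F : #|F| = q)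
    (m_dvd : (m %| q0.+1)%N)
    (K : fieldType) (iota : {rmorphism F -> K}) (x y : K)
    (K_function_field : is_function_field iota x y (curve_poly F q0 m))
    (Pinf : point iota) (Pinf_rational : rational_point Pinf)
    (a b : F) (ab_infinity : point_at_infinity (curve_poly F q0 m) a b)
    (Pinf_centre : centred_at x y Pinf a b 0) :
  forall n : nat,
    weierstrass_semigroup Pinf n <-> numerical_semigroup2 m q0 n.
Proof.
have q0_gt1 : (1 < q0)%N by rewrite q0_def -(exp1n e) ltn_exp2r ?prime_gt1.
have m_gt0 : (0 < m)%N by exact: dvdn_gt0 m_dvd.
have q0_char : [pchar F].-nat q0.
  have pF : p \in [pchar F].
    apply: (@card_finPcharP F p (e * 2)) => //.
    by rewrite card_F q_def q0_def expnM.
  by rewrite q0_def pnatX pnatE // pF.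
have co_mq0 : coprime m q0 := coprime_dvdl m_dvd (coprimeSn q0).
have Px : Pinf x < 0.
  have x0 := x_neq0 q0_gt1 K_function_field.
  have y0 := y_neq0 q0_gt1 K_function_field.
  have [ab0 [t [t0 txa tyb]]] := Pinf_centre.
  rewrite rmorph0 subr0 /vanishes_at (negbTE t0) /= => Pt.
  have [a0|a0] := eqVneq a 0; last first.
    have [_] := ord_vanishes a0 txa; rewrite ordM //; lia.
  have b0 : b != 0 by apply: contraNneq ab0 => b0; rewrite a0 b0.
  have [_] := ord_vanishes b0 tyb; rewrite ordM // => Pty.
  (* A pole of y is also one of x, because y ^ m = x ^ q0 + x. *)
  rewrite ltNge; apply/negP => Px.
  have xP : regular_at Pinf x by rewrite /regular_at Px orbT.
  have : regular_at Pinf (y ^+ m).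
    by rewrite -(curve_eq K_function_field) regularD ?regularX.
  rewrite /regular_at expf_eq0 (negbTE y0) andbF /= ordX // pmulr_lge0 //; lia.
move=> n.
exact: (weierstrass_semigroup_pole q0_gt1 m_gt0 q0_char K_function_field).
Qed.
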